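(* Let $T$ be the statement: ''Every ranked real matrix with at least two columns can be transformed into reduced row echelon form by applying elementary row operations.'' Then $T$ is equivalent to LPO.
   Context: The equivalence is to be proved within Bishop-style constructive mathematics (intuitionistic logic; the law of excluded middle is not available). LPO (Limited Principle of Omniscience) is the statement: for every $\alpha\in\{0,1\}^{\mathbb{N}}$, either $\forall n:\alpha_n=0$ or $\exists n:\alpha_n=1$. For real numbers, $x\neq y$ means that $x$ and $y$ are apart: there is a rational $q>0$ with $|x-y|>q$. For vectors, $\mathbf{x}\neq\mathbf{y}$ means that some coordinate of $\mathbf{x}$ is apart from the corresponding coordinate of $\mathbf{y}$. Vectors $\mathbf{x}_1,\dots,\mathbf{x}_m$ are independent if for all $\beta\in\mathbb{R}^m$, $\beta\neq\mathbf{0}$ implies $\sum_i\beta_i\mathbf{x}_i\neq\mathbf{0}$. A basis of a vector space $V$ is a finite independent family whose span is $V$; the dimension of $V$, when a basis exists, is the number of elements of a basis. A matrix $A$ is ranked, with $\operatorname{rank}A=r$, if the span $\operatorname{col}A$ of its columns has dimension $r$. Elementary row operations: (1) exchanging two rows; (2) multiplying a row by a number apart from $0$; (3) adding a multiple of a row to another row. A matrix is in row echelon form if: (1) every row either consists of zero or more $0$'s followed by an entry apart from $0$ (and then arbitrary entries), or is the zero row; (2) if a row has more initial zeroes than another row, it is below the row with fewer initial zeroes; (3) two rows can have the same number of initial zeroes only if both are identically $\mathbf{0}$. It is in reduced row echelon form if moreover the first entry apart from $0$ in each nonzero row is $1$, and all entries above such an initial $1$ are $0$. *)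

(* Defs.v *)
From Stdlib Require Import QArith Relations.
From Stdlib Require Import ConstructiveCauchyReals ConstructiveCauchyRealsMult
  ConstructiveCauchyAbs.
From mathcomp Require Import all_boot perm matrix.

Set Implicit Arguments.
Unset Strict Implicit.
Unset Printing Implicit Defensive.

(* Everything below is meant to be read, and proved, in plain intuitionistic
   type theory.  The real numbers are the constructive Cauchy reals [CReal]:
   rational sequences with an explicit modulus.  The axiomatic [R] of the
   standard library is unsuitable because its axiom [sig_forall_dec] is a form
   of LPO.  Equality of reals is the setoid equality [CRealEq] ("=="), not
   Leibniz equality. *)
Local Open Scope CReal_scope.

Definition LPO : Prop :=
  forall alpha : nat -> bool,
    (forall n, alpha n = false) \/ (exists n, alpha n = true).

(* [CRealLtProp] is the Prop-valued copy of the order [CRealLt : Set];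
   [CRealLtForget] and [CRealLtEpsilon] convert between them without axioms. *)
Definition apart (x y : CReal) : Prop :=
  exists q : Q, Qlt (0 # 1) q /\ CRealLtProp (inject_Q q) (CReal_abs (x - y)).

Definition vec (n : nat) : Type := 'I_n -> CReal.

Definition vec0 (n : nat) : vec n := fun=> 0.

Definition vec_eq (n : nat) (x y : vec n) : Prop := forall i, x i == y i.

Definition vec_apart (n : nat) (x y : vec n) : Prop :=
  exists i, apart (x i) (y i).

Definition lincomb (m n : nat) (beta : vec m) (x : 'I_m -> vec n) : vec n :=
  fun k => \big[CReal_plus/inject_Q 0]_(i < m) (beta i * x i k).

Definition independent (m n : nat) (x : 'I_m -> vec n) : Prop :=
  forall beta : vec m,
    vec_apart beta (@vec0 m) -> vec_apart (lincomb beta x) (@vec0 n).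

Definition span (m n : nat) (x : 'I_m -> vec n) (v : vec n) : Prop :=
  exists beta : vec m, vec_eq v (lincomb beta x).

(* A space of vectors is given by its membership predicate. *)
Definition is_basis (n r : nat) (V : vec n -> Prop) (b : 'I_r -> vec n) : Prop :=
  independent b /\ (forall v, span b v <-> V v).

Definition has_dim (n : nat) (V : vec n -> Prop) (r : nat) : Prop :=
  exists b : 'I_r -> vec n, is_basis V b.

Definition col_space (m n : nat) (A : 'M[CReal]_(m, n)) : vec m -> Prop :=
  span (fun (j : 'I_n) (i : 'I_m) => A i j).

Definition has_rank (m n : nat) (A : 'M[CReal]_(m, n)) (r : nat) : Prop :=
  has_dim (col_space A) r.

Definition ranked (m n : nat) (A : 'M[CReal]_(m, n)) : Prop :=
  exists r, has_rank A r.

Definition scale_row (m n : nat) (i : 'I_m) (c : CReal) (A : 'M[CReal]_(m, n)) :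
    'M[CReal]_(m, n) :=
  \matrix_(k, l) if k == i :> 'I_m then c * A k l else A k l.

(* Adds [c] times row [i] to row [j]. *)
Definition add_row (m n : nat) (i j : 'I_m) (c : CReal) (A : 'M[CReal]_(m, n)) :
    'M[CReal]_(m, n) :=
  \matrix_(k, l) if k == j :> 'I_m then A k l + c * A i l else A k l.

Inductive elem_row_op (m n : nat) (A : 'M[CReal]_(m, n)) :
    'M[CReal]_(m, n) -> Prop :=
| Exchange (i j : 'I_m) : elem_row_op A (xrow i j A)
| Scale (i : 'I_m) (c : CReal) : apart c 0 -> elem_row_op A (scale_row i c A)
| AddMultiple (i j : 'I_m) (c : CReal) :
    i <> j -> elem_row_op A (add_row i j c A).

Definition row_transforms (m n : nat) (A B : 'M[CReal]_(m, n)) : Prop :=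
  clos_refl_trans 'M[CReal]_(m, n) (@elem_row_op m n) A B.

Definition zero_row (m n : nat) (A : 'M[CReal]_(m, n)) (i : 'I_m) : Prop :=
  forall l : 'I_n, A i l == 0.

Definition leading (m n : nat) (A : 'M[CReal]_(m, n)) (i : 'I_m) (j : 'I_n) :
    Prop :=
  (forall l : 'I_n, (l < j)%N -> A i l == 0) /\ apart (A i j) 0.

(* Row [i] has exactly [k] initial zeroes; a zero row has [n] of them. *)
Definition initial_zeroes (m n : nat) (A : 'M[CReal]_(m, n)) (i : 'I_m)
    (k : nat) : Prop :=
  (zero_row A i /\ k = n) \/ (exists j : 'I_n, leading A i j /\ k = j).

Definition row_echelon (m n : nat) (A : 'M[CReal]_(m, n)) : Prop :=
  [/\ forall i, (exists j, leading A i j) \/ zero_row A i,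
      forall i1 i2 k1 k2,
        initial_zeroes A i1 k1 -> initial_zeroes A i2 k2 ->
        (k2 < k1)%N -> (i2 < i1)%N
    & forall i1 i2 k,
        i1 <> i2 -> initial_zeroes A i1 k -> initial_zeroes A i2 k ->
        zero_row A i1 /\ zero_row A i2].

Definition reduced_row_echelon (m n : nat) (A : 'M[CReal]_(m, n)) : Prop :=
  row_echelon A /\
  (forall i j, leading A i j ->
     A i j == 1 /\ (forall i' : 'I_m, (i' < i)%N -> A i' j == 0)).

(* Main.v *)
Require Import Defs.
From Stdlib Require Import Qabs Qpower Lqa Lia Relations ConstructiveExtra.
From Stdlib Require Import ConstructiveCauchyReals ConstructiveCauchyRealsMult
  ConstructiveCauchyAbs.
From mathcomp Require Import all_boot perm matrix.

Set Implicit Arguments.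
Unset Strict Implicit.
Unset Printing Implicit Defensive.

Local Open Scope CReal_scope.

(** Both directions turn on whether a real number can be sorted into being
    zero or being apart from zero.

    From the echelon form to LPO.  For every real [a] the one-row matrix
    (a, 1) has rank 1, because its columns span the line whatever [a] is.
    Row operations on a single row can only multiply it by a number [c] apart
    from zero ([row_transforms_single]), so an echelon form is (c a, c) up to
    equality.  Its definition says where the row has its first entry apart
    from zero: if in the first column, then [a] is apart from zero, and
    otherwise [c a], hence [a], is zero ([rref_decides]).  A binary sequence
    is encoded by the real [encode alpha], which is 2^-i when [i] is the first
    index with [alpha i = true], and which is zero when there is no such
    index.  It is approximated by inspecting finite prefixes of [alpha].  To
    sort this real number is to decide whether [alpha] takes the value [true].

    From LPO to the echelon form.  Comparing the [z]-th approximation of [x]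
    with 2 * 2^z is a decidable question, and [x] is zero if and only if the
    comparison never shows it to be apart from zero; LPO applied to these
    comparisons sorts [x] ([LPO_eq0_or_apart]).  Then the usual Gauss-Jordan
    elimination can be carried out: column by column, either all candidate
    entries are zero, or one of them is invertible and serves as pivot
    ([create_pivot], [reduced_upto_step]).

    No step uses a classical principle: what the proof needs about apartness
    it reads off from a witness. *)

#[local] Hint Resolve CRealEq_refl : core.

(** * Apartness from zero *)

(** The rational margin in the definition of apartness is recovered from bare
    positivity by the density of the rationals. *)
Lemma apart0_abs x : apart x 0 <-> CRealLtProp 0 (CReal_abs x).
Proof.
have abs_sub0 : CReal_abs (x - 0) == CReal_abs x.
  by apply: CReal_abs_morph; ring.
split.
  move=> [q [q_gt0 /CRealLtEpsilon lt_q_x]]; apply: CRealLtForget.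
  apply: (CReal_lt_le_trans _ _ _ (CReal_injectQPos _ q_gt0)).
  exact: CRealLt_asym (CRealLt_proper_r _ _ _ abs_sub0 lt_q_x).
move=> /CRealLtEpsilon /CRealQ_dense[q [q_gt0 lt_q_x]]; exists q; split.
  exact: lt_inject_Q.
exact/CRealLtForget/(CRealLt_proper_r _ _ _ (CRealEq_sym _ _ abs_sub0)).
Qed.

(** The relation [#] lives in [Set] and apartness in [Prop]; passing from the
    latter to the former is possible because a strict inequality between
    Cauchy reals is semi-decidable, so that an index witnessing it can be found
    by search. *)
Lemma apart0_appart x : apart x 0 -> x # 0.
Proof. by move=> /apart0_abs /CRealLtEpsilon /CReal_abs_appart_0. Qed.

Lemma appart_apart0 x : x # 0 -> apart x 0.
Proof.
move=> x_neq0; apply/apart0_abs/CRealLtForget.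
case: x_neq0 => [x_lt0 | x_gt0]; last first.
  exact: CReal_lt_le_trans x_gt0 (CReal_le_abs x).
apply: CRealLt_proper_r (CReal_abs_opp x) _.
exact: CReal_lt_le_trans (CReal_neg_lt_pos _ x_lt0) (CReal_le_abs (- x)).
Qed.

Lemma eq0_not_apart x : x == 0 -> ~ apart x 0.
Proof.
move=> [x_ge0 x_le0] /apart0_appart[x_lt0 | x_gt0]; first exact: x_ge0.
exact: x_le0.
Qed.

Lemma apart0_morph x y : x == y -> apart x 0 -> apart y 0.
Proof.
move=> eq_xy /apart0_appart x_neq0; apply: appart_apart0.
by case: x_neq0 => ?; [left; exact: CRealLt_proper_l eq_xy _
                      |right; exact: CRealLt_proper_r eq_xy _].
Qed.

Lemma apart0_mulr x y : apart (x * y) 0 -> apart y 0.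
Proof.
move=> /apart0_abs /CRealLtEpsilon xy_gt0; apply/apart0_abs/CRealLtForget.
have eq_abs : CReal_abs (x * y) == CReal_abs y * CReal_abs x.
  by rewrite CReal_abs_mult; ring.
have /CReal_mult_pos_appart_zero[//|abs_lt0] :=
  CRealLt_proper_r _ _ _ eq_abs xy_gt0.
by case: (CReal_abs_pos y).
Qed.

Lemma apart0_mul x y : apart x 0 -> apart y 0 -> apart (x * y) 0.
Proof.
move=> /apart0_abs /CRealLtEpsilon x_gt0 /apart0_abs /CRealLtEpsilon y_gt0.
apply/apart0_abs/CRealLtForget.
apply: (CRealLt_proper_r _ _ _ (CRealEq_sym _ _ (CReal_abs_mult x y))).
exact: CReal_mult_lt_0_compat.
Qed.

Lemma apart1_0 : apart 1 0.
Proof. by apply: appart_apart0; right; exact: CRealLt_0_1. Qed.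

Lemma apart0_inverse x : apart x 0 -> exists y, apart y 0 /\ y * x == 1.
Proof.
move=> /apart0_appart x_neq0; have inv_l := CReal_inv_l x x_neq0.
exists (CReal_inv x x_neq0); split=> //.
apply: (@apart0_mulr x); apply: apart0_morph apart1_0.
by rewrite CReal_mult_comm; exact: CRealEq_sym.
Qed.

(** * The real number that encodes a binary sequence *)

Definition first_true (alpha : nat -> bool) (N : nat) : nat :=
  find alpha (iota 0 N).

(** The value of 2^-i, [i] the first index with [alpha i = true], as far as
    the first [N] terms of [alpha] tell; it stays 0 as long as they are all
    [false]. *)
Definition stage (alpha : nat -> bool) (N : nat) : Q :=
  if (first_true alpha N < N)%N
  then (2 ^ (- Z.of_nat (first_true alpha N)))%Q else 0%Q.

Lemma pow2_pos (k : Z) : (0 < 2 ^ k)%Q.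
Proof. exact: Qpower_0_lt. Qed.

Lemma pow2_le (j k : Z) : (j <= k)%Z -> (2 ^ j <= 2 ^ k)%Q.
Proof. by move=> le_jk; apply: Qpower_le_compat_l. Qed.

Lemma pow2_succ (k : Z) : (2 ^ (k + 1) == 2 * 2 ^ k)%Q.
Proof. by rewrite Qpower_plus //; ring. Qed.

Lemma first_true_le alpha N n :
  alpha n = true -> (n < N)%N -> (first_true alpha N <= n)%N.
Proof.
move=> alpha_n lt_nN; rewrite leqNgt; apply/negP=> lt_n.
by have := before_find 0%N lt_n; rewrite nth_iota // add0n alpha_n.
Qed.

Lemma first_true_true alpha N :
  (first_true alpha N < N)%N -> alpha (first_true alpha N) = true.
Proof.
move=> lt_N; have := lt_N; rewrite /first_true -[X in (_ < X)%N](size_iota 0).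
by rewrite -has_find => /(nth_find 0%N); rewrite nth_iota.
Qed.

Lemma stage_bounds alpha N : (0 <= stage alpha N <= 1)%Q.
Proof.
rewrite /stage; case: ifP => _; last by split; lra.
split; first exact/Qlt_le_weak/pow2_pos.
by apply: (@pow2_le _ 0); lia.
Qed.

Lemma stage_true alpha N n :
  alpha n = true -> (n < N)%N -> (2 ^ (- Z.of_nat n) <= stage alpha N)%Q.
Proof.
move=> alpha_n lt_nN; have le_n := first_true_le alpha_n lt_nN.
rewrite /stage (leq_ltn_trans le_n lt_nN); apply: pow2_le.
by move/leP: le_n; lia.
Qed.

Lemma stage_neq0 alpha N : ~ (stage alpha N == 0)%Q -> exists n, alpha n = true.
Proof.
rewrite /stage; case: ifP => [lt_N _ | _ []] //.
by exists (first_true alpha N); exact: first_true_true.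
Qed.

(** Once nonzero, the stages are constant; while they are still 0 after [N]
    terms, the first index to come is at least [N]. *)
Lemma stage_diff alpha N M :
  (N <= M)%N ->
  (0 <= stage alpha M - stage alpha N <= 2 ^ (- Z.of_nat N))%Q.
Proof.
move=> le_NM; have pN := pow2_pos (- Z.of_nat N).
have split_M : first_true alpha M =
    if (first_true alpha N < N)%N then first_true alpha N
    else (N + find alpha (iota N (M - N)))%N.
  rewrite /first_true -(subnKC le_NM) iotaD add0n find_cat has_find size_iota.
  by rewrite subnKC.
rewrite /stage split_M; case lt_N: (first_true alpha N < N)%N.
  by rewrite (leq_trans lt_N le_NM); split; lra.
case: ifP => _; last by split; lra.
set i := (_ + _)%N; have p_i := pow2_pos (- Z.of_nat i).
have le_Ni : (N <= i)%coq_nat by apply/leP; exact: leq_addr.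
have : (2 ^ (- Z.of_nat i) <= 2 ^ (- Z.of_nat N))%Q by apply: pow2_le; lia.
by split; lra.
Qed.

(** The number of terms that the approximation of precision [2 ^ p] inspects:
    one more than [- p], since the Cauchy condition is a strict inequality. *)
Definition depth (p : Z) : nat := Z.to_nat (1 - p).

Lemma stage_cauchy alpha : QCauchySeq (fun p => stage alpha (depth p)).
Proof.
move=> k p q le_pk le_qk.
have depth_pow r : (r <= k)%Z -> (2 ^ (- Z.of_nat (depth r)) < 2 ^ k)%Q.
  move=> le_rk; apply: (@Qle_lt_trans _ (2 ^ (k - 1))).
    by apply: pow2_le; rewrite /depth; lia.
  have := pow2_succ (k - 1); rewrite Z.sub_add => ->.
  by have := pow2_pos (k - 1); lra.
apply/Qabs_Qlt_condition.
have [le_pq | /ltnW le_qp] := leqP (depth p) (depth q).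
  by have := stage_diff alpha le_pq; have := depth_pow _ le_pk; split; lra.
by have := stage_diff alpha le_qp; have := depth_pow _ le_qk; split; lra.
Qed.

Lemma stage_bound alpha : QBound (fun p => stage alpha (depth p)) 1.
Proof.
move=> p; apply/Qabs_Qlt_condition; have := stage_bounds alpha (depth p).
by rewrite [(2 ^ 1)%Q]/=; split; lra.
Qed.

Definition encode (alpha : nat -> bool) : CReal :=
  mkCReal _ _ (stage_cauchy alpha) (stage_bound alpha).

(** A positive lower bound on the distance to 0 singles out one stage that is
    not 0, and a prefix of [alpha] in which to look. *)
Lemma encode_apart0 alpha :
  apart (encode alpha) 0 -> exists n, alpha n = true.
Proof.
move=> /apart0_appart[] [p]; rewrite [X in Qlt _ X]/= => lt_p;
  have := pow2_pos p; move=> p_gt0;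
  by apply: (@stage_neq0 _ (depth p)) => eq0; move: lt_p; rewrite eq0; lra.
Qed.

Lemma encode_eq0 alpha : encode alpha == 0 -> forall n, alpha n = false.
Proof.
move=> /CRealEq_diff eq0 n; apply/negbTE/negP => alpha_n.
(* The real is at least 2^-n, and equality with 0 bounds its [p]-th
   approximation by 2^(p+1), which is 2^-(n+1) for this [p]. *)
pose p := (- Z.of_nat n - 2)%Z.
have lt_n : (n < depth p)%N by apply/ltP; rewrite /depth /p; lia.
have /Qabs_Qle_condition : (Qabs (stage alpha (depth p) - 0) <= 2 * 2 ^ p)%Q.
  exact: eq0.
have := stage_true alpha_n lt_n; have := pow2_succ p.
have := pow2_succ (p + 1); have := pow2_pos p.
have -> : (p + 1 + 1 = - Z.of_nat n)%Z by rewrite /p; lia.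
lra.
Qed.

(** * Row operations on a single row *)

(** An exchange is trivial, and there is no other row of which a multiple could
    be added, so that only scaling remains. *)
Lemma row_transforms_single n (A B : 'M[CReal]_(1, n)) :
  row_transforms A B ->
  exists c, apart c 0 /\ forall i l, B i l == c * A i l.
Proof.
elim=> {A B} [A B op | A | A B C _ [c [c0 Bc]] _ [d [d0 Cd]]].
- case: op => [i j | i c c0 | i j c []].
  + exists 1; split; first exact: apart1_0.
    by move=> k l; rewrite !ord1 mxE tperm1 perm1 CReal_mult_1_l.
  + by exists c; split=> // k l; rewrite mxE !ord1 eqxx.
  + by rewrite !ord1.
- by exists 1; split=> [|i l]; [exact: apart1_0 | rewrite CReal_mult_1_l].
- exists (d * c); split; first exact: apart0_mul.
  by move=> i l; rewrite Cd Bc -CReal_mult_assoc.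
Qed.

(** * The dichotomy for real numbers under LPO *)

(** LPO speaks of sequences indexed by natural numbers, the approximations of
    [x] are indexed by integers; the bijection [Z_inj_nat] mediates. *)
Lemma LPO_eq0_or_apart : LPO -> forall x, x == 0 \/ apart x 0.
Proof.
move=> lpo x.
pose large z :=
  if Qlt_le_dec (2 * 2 ^ z) (Qabs (ConstructiveCauchyReals.seq x z))
  then true else false.
case: (lpo (fun n => large (Z_inj_nat_rev n))) => [all_small | [n]].
  left; apply/CRealEq_diff => z; have := all_small (Z_inj_nat z).
  rewrite Z_inj_nat_id /large; case: Qlt_le_dec => //= small _.
  change (Qabs (ConstructiveCauchyReals.seq x z - 0) <= 2 * 2 ^ z)%Q.
  by rewrite /Qminus Qplus_0_r.
rewrite /large; case: Qlt_le_dec => // lt_z _; right; apply: appart_apart0.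
by case: (CReal_abs_appart_zero _ _ lt_z); [right | left].
Qed.

(** The search for a pivot in column [k], among the rows that do not yet have
    one. *)
Lemma eq0_or_apart_below m n (A : 'M[CReal]_(m, n)) (k : 'I_n) (r : nat) :
  LPO ->
  (forall i : 'I_m, (r <= i)%N -> A i k == 0) \/
  (exists2 i : 'I_m, (r <= i)%N & apart (A i k) 0).
Proof.
move=> lpo.
suff search (s : seq 'I_m) :
    (forall i, i \in s -> (r <= i)%N -> A i k == 0) \/
    (exists2 i : 'I_m, (r <= i)%N & apart (A i k) 0).
  case: (search (enum 'I_m)) => [all0 | ?]; [left | by right].
  by move=> i; apply: all0; rewrite mem_enum.
elim: s => [|i s [all0 | ?]]; [by left | | by right].
have [le_ri | lt_ir] := leqP r i; last first.
  by left=> j; rewrite inE => /orP[/eqP-> | /all0//]; rewrite leqNgt lt_ir.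
case: (LPO_eq0_or_apart lpo (A i k)) => [i0 | i_apart]; last by right; exists i.
by left=> j; rewrite inE => /orP[/eqP-> | /all0].
Qed.

(** * Gauss-Jordan elimination *)

Lemma leading_unique m n (A : 'M[CReal]_(m, n)) i j j' :
  leading A i j -> leading A i j' -> j = j'.
Proof.
move=> [before_j at_j] [before_j' at_j']; apply/val_inj.
by case: (ltngtP j j') => // [/before_j' | /before_j] /eq0_not_apart.
Qed.

(** The entries of the pivot row to the left of the pivot are zero, so that
    subtracting multiples of that row does not disturb these columns. *)
Lemma clear_column m n (C : 'M[CReal]_(m, n)) (r : 'I_m) (k : 'I_n) :
  C r k == 1 -> (forall l : 'I_n, (l < k)%N -> C r l == 0) ->
  exists D : 'M[CReal]_(m, n),
    [/\ row_transforms C D,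
        forall i (l : 'I_n), (l < k)%N -> D i l == C i l,
        D r k == 1
      & forall i, i <> r -> D i k == 0].
Proof.
move=> pivot1 before0.
suff clear_rows (s : seq 'I_m) :
    exists D : 'M[CReal]_(m, n),
      [/\ row_transforms C D,
          forall i (l : 'I_n), (l < k)%N -> D i l == C i l,
          forall l, D r l == C r l
        & forall i, i \in s -> i <> r -> D i k == 0].
  have [D [CD left_same row_same cleared]] := clear_rows (enum 'I_m).
  exists D; split=> //; first by rewrite row_same.
  by move=> i; apply: cleared; rewrite mem_enum.
elim: s => [|i s [D [CD left_same row_same cleared]]].
  by exists C; split=> //; exact: rt_refl.
have [-> | /eqP i_neq_r] := eqVneq i r.
  by exists D; split=> // j; rewrite inE => /orP[/eqP-> | /cleared].
exists (add_row r i (- D i k) D); split.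
- apply: rt_trans CD (rt_step _ _ _ _ _).
  by apply: AddMultiple => /esym.
- move=> j l lt_lk; rewrite mxE; case: eqP => [_|_]; last exact: left_same.
  by rewrite left_same // row_same before0 // CReal_mult_0_r CReal_plus_0_r.
- by move=> l; rewrite mxE; case: eqP => [/esym|].
- move=> j; rewrite inE mxE; case: eqP => [-> _ _ | _ /= /cleared //].
  by rewrite row_same pivot1 CReal_mult_1_r CReal_plus_opp_r.
Qed.

(** The rows from [r] on vanish to the left of column [k]: exchanging and
    scaling them, and adding them to other rows, leaves those columns as they
    are. *)
Lemma create_pivot m n (A : 'M[CReal]_(m, n)) (r p : 'I_m) (k : 'I_n) :
  (r <= p)%N -> apart (A p k) 0 ->
  (forall (i : 'I_m) (l : 'I_n), (r <= i)%N -> (l < k)%N -> A i l == 0) ->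
  exists B : 'M[CReal]_(m, n),
    [/\ row_transforms A B,
        forall i (l : 'I_n), (l < k)%N -> B i l == A i l,
        B r k == 1
      & forall i, i <> r -> B i k == 0].
Proof.
move=> le_rp /apart0_inverse[c [c_apart c_inv]] below0.
pose C := scale_row r c (xrow r p A).
have AC : row_transforms A C.
  apply: rt_trans (rt_step _ _ _ _ (Exchange A r p)) (rt_step _ _ _ _ _).
  exact: Scale.
have left_same i (l : 'I_n) : (l < k)%N -> C i l == A i l.
  move=> lt_lk; rewrite !mxE; case: tpermP => [-> | -> | /eqP/negPf-> _ //].
    by rewrite eqxx !below0 // CReal_mult_0_r.
  by case: eqP => _; rewrite !below0 // CReal_mult_0_r.
have pivot1 : C r k == 1 by rewrite !mxE eqxx tpermL.
have before0 (l : 'I_n) : (l < k)%N -> C r l == 0.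
  by move=> lt_lk; rewrite left_same // below0.
have [B [CB left_same' row_k cleared]] := clear_column pivot1 before0.
exists B; split=> //; first exact: rt_trans AC CB.
by move=> i l lt_lk; rewrite left_same' // left_same.
Qed.

(** The invariant of the elimination: the first [k] columns are in reduced row
    echelon form, with pivots exactly in the first [r] rows.  The pivot columns
    are cleared entirely, below the pivot as well as above it. *)
Definition reduced_upto m n (r k : nat) (A : 'M[CReal]_(m, n)) : Prop :=
  [/\ forall i : 'I_m, (i < r)%N ->
        exists j : 'I_n, [/\ (j < k)%N, leading A i j, A i j == 1
                          & forall i', i' <> i -> A i' j == 0],
      forall (i1 i2 : 'I_m) j1 j2, (i1 < i2)%N -> (i2 < r)%N ->
        leading A i1 j1 -> leading A i2 j2 -> (j1 < j2)%N
    & forall (i : 'I_m) (l : 'I_n), (r <= i)%N -> (l < k)%N -> A i l == 0].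

Lemma leading_congr m n (A B : 'M[CReal]_(m, n)) i (j : 'I_n) :
  (forall l : 'I_n, (l <= j)%N -> B i l == A i l) ->
  leading A i j -> leading B i j.
Proof.
move=> same [before0 at_j]; split.
  by move=> l lt_lj; rewrite same ?before0 // ltnW.
by apply: apart0_morph at_j; rewrite same.
Qed.

(** Column [k] either is zero from row [r] on, and the invariant passes to
    [k.+1] as it stands, or it yields a pivot for row [r].  In the second case
    the earlier columns do not change, and so neither do the earlier pivots. *)
Lemma reduced_upto_step m n r (k : 'I_n) (A : 'M[CReal]_(m, n)) :
  LPO -> reduced_upto r k A ->
  exists r' (B : 'M[CReal]_(m, n)),
    row_transforms A B /\ reduced_upto r' k.+1 B.
Proof.
move=> lpo [pivots increasing below0].
have [col0 | [p le_rp p_apart]] := eq0_or_apart_below A k r lpo.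
  exists r, A; split; first exact: rt_refl.
  split=> // [i lt_ir | i l le_ri].
    have [j [lt_jk lead1 one1 col1]] := pivots i lt_ir.
    by exists j; split=> //; exact: leqW.
  rewrite ltnS leq_eqVlt => /orP[/eqP/val_inj-> | ]; first exact: col0.
  exact: below0.
have lt_rm : (r < m)%N by exact: leq_ltn_trans le_rp (ltn_ord p).
have [B [AB left_same pivot1 cleared]] :=
  @create_pivot m n A (Ordinal lt_rm) p k le_rp p_apart below0.
set q := Ordinal lt_rm in pivot1 cleared.
have lead_q : leading B q k.
  split; last by apply: apart0_morph apart1_0; rewrite pivot1.
  by move=> l lt_lk; rewrite left_same // below0.
have old_pivot (i : 'I_m) : (i < r)%N ->
    exists j : 'I_n, [/\ (j < k)%N, leading A i j, leading B i j, B i j == 1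
                      & forall i', i' <> i -> B i' j == 0].
  move=> lt_ir; have [j [lt_jk lead1 one1 col1]] := pivots i lt_ir.
  exists j; split=> //; last 1 first.
  - by move=> i' neq; rewrite left_same // col1.
  - apply: leading_congr lead1 => l le_lj.
    by rewrite left_same //; exact: leq_ltn_trans lt_jk.
  - by rewrite left_same.
exists r.+1, B; split=> //; split.
- move=> i; rewrite ltnS leq_eqVlt => /orP[/eqP i_eq_r | lt_ir].
    have -> : i = q by exact: val_inj.
    by exists k; split.
  have [j [lt_jk _ lead_j one_j col_j]] := old_pivot i lt_ir.
  by exists j; split=> //; exact: leqW.
- move=> i1 i2 j1 j2 lt_i12; rewrite ltnS leq_eqVlt.
  case/orP=> [/eqP i2_eq_r | lt_i2r].
    have -> : i2 = q by exact: val_inj.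
    have lt_i1r : (i1 < r)%N by rewrite -i2_eq_r.
    have [j [lt_jk _ lead_j _ _]] := old_pivot i1 lt_i1r.
    by move=> /(leading_unique lead_j) <- /(leading_unique lead_q) <-.
  have [j [_ leadA leadB _ _]] := old_pivot i1 (ltn_trans lt_i12 lt_i2r).
  have [j' [_ leadA' leadB' _ _]] := old_pivot i2 lt_i2r.
  move=> /(leading_unique leadB) <- /(leading_unique leadB') <-.
  exact: increasing leadA leadA'.
- move=> i l lt_ri; rewrite ltnS leq_eqVlt => /orP[/eqP/val_inj-> | lt_lk].
    by apply: cleared => i_eq_q; rewrite i_eq_q ltnn in lt_ri.
  by rewrite left_same // below0 // ltnW.
Qed.

Lemma reduced_upto_exists m n (A : 'M[CReal]_(m, n)) (k : nat) :
  LPO -> (k <= n)%N ->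
  exists r (B : 'M[CReal]_(m, n)), row_transforms A B /\ reduced_upto r k B.
Proof.
move=> lpo; elim: k => [_ | k IHk lt_kn].
  by exists 0%N, A; split; [exact: rt_refl | split].
have [r [B [AB redB]]] := IHk (ltnW lt_kn).
have [r' [C [BC redC]]] := reduced_upto_step (k := Ordinal lt_kn) lpo redB.
by exists r', C; split=> //; exact: rt_trans AB BC.
Qed.

(** With all columns treated, the rows from [r] on are zero, and the rows above
    have strictly increasing numbers of initial zeroes, all less than [n]. *)
Lemma reduced_upto_rref m n r (B : 'M[CReal]_(m, n)) :
  reduced_upto r n B -> reduced_row_echelon B.
Proof.
move=> [pivots increasing below0].
have zero_below (i : 'I_m) : (r <= i)%N -> zero_row B i.
  by move=> le_ri l; exact: below0.
have leading_lt i j : leading B i j -> (i < r)%N.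
  move=> [_ at_j]; rewrite ltnNge; apply/negP.
  by move=> /zero_below/(_ j)/eq0_not_apart.
have zeroes_lt (i : 'I_m) z : (i < r)%N -> initial_zeroes B i z ->
    exists2 j : 'I_n, leading B i j & z = j.
  move=> /pivots[j [_ [_ at_j] _ _]] [[zero_i _] | [j' []]]; last by exists j'.
  by case: (eq0_not_apart (zero_i j)).
have zeroes_ge (i : 'I_m) z : (r <= i)%N -> initial_zeroes B i z -> z = n.
  move=> le_ri [[_ ->//] | [j [/leading_lt]]].
  by rewrite ltnNge le_ri.
have zeroes_le (i : 'I_m) z : initial_zeroes B i z -> (z <= n)%N.
  by move=> [[_ ->//] | [j [_ ->]]]; exact: ltnW.
split; last first.
  move=> i j lead_j.
  have [j' [_ lead_j' one_j' col_j']] := pivots i (leading_lt i j lead_j).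
  rewrite (leading_unique lead_j lead_j'); split=> // i' lt_i'i.
  by apply: col_j' => i'_eq; rewrite i'_eq ltnn in lt_i'i.
split.
- move=> i; have [le_ri | /pivots[j [_ lead_j _ _]]] := leqP r i.
    by right; exact: zero_below.
  by left; exists j.
- move=> i1 i2 z1 z2 zero1 zero2 lt_z21.
  have [le_r2 | lt_2r] := leqP r i2.
    have := zeroes_le _ _ zero1.
    by rewrite -(zeroes_ge _ _ le_r2 zero2) leqNgt lt_z21.
  have [le_r1 | lt_1r] := leqP r i1; first exact: leq_trans le_r1.
  have [j1 lead1 eq1] := zeroes_lt _ _ lt_1r zero1.
  have [j2 lead2 eq2] := zeroes_lt _ _ lt_2r zero2.
  rewrite eq1 eq2 in lt_z21; case: (ltngtP i1 i2) => // [lt_12 | eq_12].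
    by have := increasing _ _ _ _ lt_12 lt_2r lead1 lead2; rewrite ltnNge ltnW.
  rewrite (val_inj eq_12) in lead1.
  by rewrite (leading_unique lead1 lead2) ltnn in lt_z21.
- move=> i1 i2 z neq_12 zero1 zero2.
  have zeroes_ltn (i : 'I_m) : (i < r)%N -> initial_zeroes B i z -> (z < n)%N.
    by move=> lt_ir /(zeroes_lt i z lt_ir)[j _ ->].
  have [le_r1 | lt_1r] := leqP r i1; have [le_r2 | lt_2r] := leqP r i2.
  + by split; exact: zero_below.
  + have := zeroes_ltn _ lt_2r zero2.
    by rewrite (zeroes_ge _ _ le_r1 zero1) ltnn.
  + have := zeroes_ltn _ lt_1r zero1.
    by rewrite (zeroes_ge _ _ le_r2 zero2) ltnn.
  have [j1 lead1 eq1] := zeroes_lt _ _ lt_1r zero1.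
  have [j2 lead2 eq2] := zeroes_lt _ _ lt_2r zero2.
  case: (ltngtP i1 i2) => [lt_12 | lt_21 | /val_inj//].
    have := increasing _ _ _ _ lt_12 lt_2r lead1 lead2.
    by rewrite -eq1 -eq2 ltnn.
  have := increasing _ _ _ _ lt_21 lt_1r lead2 lead1.
  by rewrite -eq1 -eq2 ltnn.
Qed.

Lemma LPO_rref m n (A : 'M[CReal]_(m, n)) :
  LPO ->
  exists B : 'M[CReal]_(m, n), row_transforms A B /\ reduced_row_echelon B.
Proof.
move=> lpo; have [r [B [AB /reduced_upto_rref redB]]] :=
  reduced_upto_exists A lpo (leqnn n).
by exists B.
Qed.

(** * A ranked matrix whose echelon form decides a real number *)

Definition row_with_one (a : CReal) : 'M[CReal]_(1, 2) :=
  \matrix_(i, j) if j == ord0 then a else 1.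

(** The second column alone is a basis of the column space. *)
Lemma row_with_one_ranked a : ranked (row_with_one a).
Proof.
exists 1%N, (fun _ _ => 1); split.
  move=> beta [i]; rewrite (ord1 i) => beta0; exists ord0.
  apply: apart0_morph beta0.
  by rewrite /lincomb big_ord_recl big_ord0 CReal_plus_0_r CReal_mult_1_r.
move=> v; split=> _; last first.
  exists v => i; rewrite /lincomb big_ord_recl big_ord0 (ord1 i).
  rewrite CReal_plus_0_r CReal_mult_1_r.
  exact: CRealEq_refl.
exists (fun j => if j == ord0 then 0 else v ord0) => i.
rewrite /lincomb !big_ord_recl big_ord0 !mxE (ord1 i) /=.
by rewrite CReal_mult_0_l CReal_plus_0_l CReal_plus_0_r CReal_mult_1_r.
Qed.

(** It is the position of the leading entry of the echelon form that carries
    the decision. *)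
Lemma rref_decides a (B : 'M[CReal]_(1, 2)) :
  row_transforms (row_with_one a) B -> reduced_row_echelon B ->
  a == 0 \/ apart a 0.
Proof.
move=> /row_transforms_single[c [c_apart B_eq]] [[rows _ _] _].
have B00 : B ord0 ord0 == c * a by rewrite B_eq mxE.
have a_eq0 : B ord0 ord0 == 0 -> a == 0.
  rewrite B00 => ca0; have [d [_ dc]] := apart0_inverse c_apart.
  by rewrite -[a]CReal_mult_1_l -dc CReal_mult_assoc ca0 CReal_mult_0_r.
case: (rows ord0) => [[j [before0 at_j]] | zero0]; last by left; exact: a_eq0.
case: (posnP j) => [j_eq0 | j_gt0]; last by left; exact/a_eq0/before0.
right; apply: (@apart0_mulr c); apply: apart0_morph at_j.
by have -> : j = ord0 by exact: val_inj.
Qed.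

Local Open Scope nat_scope.

Theorem proposition4p11 :
  (forall (m n : nat) (A : 'M[CReal]_(m, n)),
     2 <= n -> ranked A ->
     exists B : 'M[CReal]_(m, n), row_transforms A B /\ reduced_row_echelon B)
  <-> LPO.
Proof.
split=> [rref alpha | lpo m n A _ _]; last exact: LPO_rref.
have [B [AB redB]] :=
  rref 1 2 _ isT (row_with_one_ranked (encode alpha)).
case: (rref_decides AB redB) => [/encode_eq0 | /encode_apart0]; first by left.
by right.
Qed.
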